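(* Let $n\ge1$. For each extension $\mathcal{L}$ of $\mathrm{BD}_1$ the following are equivalent: (i) $\mathcal{L}$ is finitary and enjoys the $n$-PCP; (ii) $\mathcal{L}$ is complete with respect to some set of substructures of $(\boldsymbol{\mathcal{DM}}_1)^n$; (iii) $\mathcal{L}$ is complete with respect to some finite set of finite structures $\langle\mathbf{L},F\rangle$ with $\mathbf{L}$ a De~Morgan lattice and $F$ an $n$-prime filter of $\mathbf{L}$. Moreover, for each finitely generated extension of $\mathrm{BD}_1$ there is some $n$ for which these conditions hold.
   Context: Formulas are built from variables using $\wedge,\vee,\neg$. A structure is a pair $\langle\mathbf{A},F\rangle$, $F\subseteq A$; a rule $\Gamma\vdash\varphi$ is valid in it if every homomorphism $v$ from the formula algebra with $v[\Gamma]\subseteq F$ has $v(\varphi)\in F$. A logic is a substitution-invariant consequence relation; it is complete w.r.t. a class of structures if its valid rules are exactly those valid in all members; an extension of $\mathcal{L}_0$ is a logic containing $\vdash_{\mathcal{L}_0}$; finitary means $\Gamma\vdash\varphi$ implies $\Gamma_0\vdash\varphi$ for some finite $\Gamma_0\subseteq\Gamma$. A finitely generated logic is one determined by a finite set of finite structures. $\mathrm{BD}_1$ (Belnap–Dunn logic) is the logic determined by all $\langle\mathbf{A},F\rangle$ with $\mathbf{A}$ a De~Morgan lattice (distributive lattice with $\neg$, $\neg\neg x=x$, De~Morgan laws) and $F$ a lattice filter; equivalently by $\boldsymbol{\mathcal{DM}}_1=\langle\mathbf{DM}_1,\{\mathsf t,\mathsf b\}\rangle$, where $\mathbf{DM}_1$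 is the De~Morgan lattice on $\{\mathsf f,\mathsf n,\mathsf b,\mathsf t\}$ with $\mathsf f<\mathsf n,\mathsf b<\mathsf t$, $\mathsf n,\mathsf b$ incomparable, $\neg\mathsf t=\mathsf f$, $\neg\mathsf n=\mathsf n$, $\neg\mathsf b=\mathsf b$. $(\boldsymbol{\mathcal{DM}}_1)^n$ is the direct power $\langle(\mathbf{DM}_1)^n,\{\mathsf t,\mathsf b\}^n\rangle$; a substructure is a subalgebra with the restricted designated set. $\mathcal{L}$ has the $n$-PCP if for all $\Gamma,\varphi_1,\dots,\varphi_{n+1},\psi$: whenever $\Gamma,\bigvee_{j\ne i}\varphi_j\vdash_{\mathcal{L}}\psi$ for each $i\in\{1,\dots,n+1\}$, then $\Gamma,\varphi_1\vee\dots\vee\varphi_{n+1}\vdash_{\mathcal{L}}\psi$. An $n$-filter is an upset $F$ such that for every non-empty finite $Y$: if $\bigwedge X\in F$ for all non-empty $X\subseteq Y$, $|X|\le n$, then $\bigwedge Y\in F$; an $n$-ideal is an $n$-filter of the order dual; a filter is $n$-prime if its complement is an $n$-ideal. *)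

(* Defs.v *)
From mathcomp Require Import all_boot.
From mathcomp Require Import boolp classical_sets functions cardinality.

Set Implicit Arguments.
Unset Strict Implicit.
Unset Printing Implicit Defensive.

Local Open Scope classical_set_scope.
Local Open Scope card_scope.

Record algebra := Algebra {
  carrier :> Type;
  meet : carrier -> carrier -> carrier;
  join : carrier -> carrier -> carrier;
  neg : carrier -> carrier;
  carrier_inhabited : inhabited carrier }.

Definition is_hom (A B : algebra) (h : A -> B) : Prop :=
  [/\ forall x y, h (meet x y) = meet (h x) (h y),
      forall x y, h (join x y) = join (h x) (h y) &
      forall x, h (neg x) = neg (h x)].

Record structure := Structure {
  alg :> algebra;
  des : set alg }.

Definition finite_structure (S : structure) : Prop := finite_set [set: S].

Inductive formula : Type :=
| Var of nat
| And of formula & formula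
| Or of formula & formula
| Neg of formula.

Definition formula_algebra : algebra :=
  Algebra And Or Neg (inhabits (Var 0)).

Definition valid (S : structure) (Gamma : set formula) (phi : formula) : Prop :=
  forall v : formula_algebra -> S, is_hom v ->
    v @` Gamma `<=` @des S -> @des S (v phi).

Record logic := Logic {
  entails :> set formula -> formula -> Prop;
  entails_refl : forall (Gamma : set formula) phi,
    Gamma phi -> entails Gamma phi;
  entails_mono : forall (Gamma Delta : set formula) phi,
    Gamma `<=` Delta -> entails Gamma phi -> entails Delta phi;
  entails_cut : forall (Gamma Delta : set formula) phi,
    Delta `<=` entails Gamma -> entails Delta phi -> entails Gamma phi;
  entails_subst : forall (s : formula_algebra -> formula_algebra),
    is_hom s -> forall (Gamma : set formula) phi,
    entails Gamma phi -> entails (s @` Gamma) (s phi) }.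

Definition class_entails (K : set structure) (Gamma : set formula)
    (phi : formula) : Prop :=
  forall S, K S -> valid S Gamma phi.

Section LogicOf.
Variable K : set structure.

Lemma class_entails_refl (Gamma : set formula) phi :
  Gamma phi -> class_entails K Gamma phi.
Proof. by move=> Gp S _ v _; apply; exists phi. Qed.

Lemma class_entails_mono (Gamma Delta : set formula) phi :
  Gamma `<=` Delta -> class_entails K Gamma phi -> class_entails K Delta phi.
Proof.
move=> GD Gp S KS v hv vD; apply: (Gp S KS v hv) => _ [g Gg <-].
by apply: vD; exists g => //; apply: GD.
Qed.

Lemma class_entails_cut (Gamma Delta : set formula) phi :
  Delta `<=` class_entails K Gamma -> class_entails K Delta phi ->
  class_entails K Gamma phi.
Proof.
move=> GD Dp S KS v hv vG; apply: (Dp S KS v hv) => _ [d Dd <-].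
exact: (GD d Dd S KS v hv vG).
Qed.

Lemma class_entails_subst (s : formula_algebra -> formula_algebra) :
  is_hom s -> forall (Gamma : set formula) phi,
  class_entails K Gamma phi -> class_entails K (s @` Gamma) (s phi).
Proof.
move=> [sA sO sN] Gamma phi Gp S KS v [vA vO vN] vG.
apply: (Gp S KS (v \o s)).
  by split=> [x y|x y|x] /=; rewrite ?sA ?sO ?sN ?vA ?vO ?vN.
by move=> _ [g Gg <-]; apply: vG; exists (s g) => //; exists g.
Qed.

Definition logic_of : logic :=
  Logic class_entails_refl class_entails_mono class_entails_cut
        class_entails_subst.

End LogicOf.

Definition complete (L : logic) (K : set structure) : Prop :=
  forall Gamma phi, L Gamma phi <-> logic_of K Gamma phi.

Definition extension (L0 L : logic) : Prop :=
  forall Gamma phi, L0 Gamma phi -> L Gamma phi.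

Definition finitary (L : logic) : Prop :=
  forall Gamma phi, L Gamma phi ->
    exists Gamma0, [/\ finite_set Gamma0, Gamma0 `<=` Gamma & L Gamma0 phi].

Definition finitely_generated (L : logic) : Prop :=
  exists K : set structure,
    [/\ finite_set K, forall S, K S -> finite_structure S & complete L K].

Record is_demorgan_lattice (A : algebra) : Prop := IsDeMorganLattice {
  dm_meetC : forall x y : A, meet x y = meet y x;
  dm_joinC : forall x y : A, join x y = join y x;
  dm_meetA : forall x y z : A, meet x (meet y z) = meet (meet x y) z;
  dm_joinA : forall x y z : A, join x (join y z) = join (join x y) z;
  dm_meetKU : forall x y : A, meet x (join x y) = x;
  dm_joinKI : forall x y : A, join x (meet x y) = x;
  dm_meetUr : forall x y z : A,
    meet x (join y z) = join (meet x y) (meet x z);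
  dm_negK : forall x : A, neg (neg x) = x;
  dm_neg_meet : forall x y : A, neg (meet x y) = join (neg x) (neg y);
  dm_neg_join : forall x y : A, neg (join x y) = meet (neg x) (neg y) }.

Definition lat_le (A : algebra) (x y : A) : Prop := meet x y = x.

Section OrderNotions.
Variables (T : Type) (le : T -> T -> Prop).

Definition upset (F : set T) : Prop := forall x y, F x -> le x y -> F y.

Definition is_inf (X : set T) (m : T) : Prop :=
  (forall x, X x -> le m x) /\
  (forall z, (forall x, X x -> le z x) -> le z m).

Definition n_filter (n : nat) (F : set T) : Prop :=
  upset F /\
  forall Y : set T, finite_set Y -> Y !=set0 ->
    (forall X : set T, X `<=` Y -> X !=set0 -> X #<= `I_n ->
       forall m, is_inf X m -> F m) ->
    forall m, is_inf Y m -> F m.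

End OrderNotions.

Definition n_ideal (T : Type) (le : T -> T -> Prop) (n : nat) (I : set T) :=
  n_filter (fun x y => le y x) n I.

(* Nonemptiness is not required, so these are exactly the 1-filters. The empty
   filter must be allowed in n_prime_filter: the subalgebra {n} of DM1 has no
   designated element, and determines a logic whose models <L, F> all have
   F empty or F = L. *)
Definition lattice_filter (A : algebra) (F : set A) : Prop :=
  upset (@lat_le A) F /\ forall x y, F x -> F y -> F (meet x y).

Definition n_prime_filter (A : algebra) (n : nat) (F : set A) : Prop :=
  lattice_filter F /\ n_ideal (@lat_le A) n (~` F).

Definition BD1 : logic :=
  logic_of [set S : structure |
    is_demorgan_lattice S /\ lattice_filter (@des S)].

Inductive four : Type := Ff | Fn | Fb | Ft.

Definition four_meet (x y : four) : four :=
  match x, y with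
  | Ft, z => z
  | z, Ft => z
  | Fn, Fn => Fn
  | Fb, Fb => Fb
  | _, _ => Ff
  end.

Definition four_join (x y : four) : four :=
  match x, y with
  | Ff, z => z
  | z, Ff => z
  | Fn, Fn => Fn
  | Fb, Fb => Fb
  | _, _ => Ft
  end.

Definition four_neg (x : four) : four :=
  match x with Ff => Ft | Fn => Fn | Fb => Fb | Ft => Ff end.

Definition DM1 : structure :=
  @Structure (Algebra four_meet four_join four_neg (inhabits Ft)) [set Ft; Fb].

(* Used instead of 'I_n, whose universe predArgType is too large for the carrier
   of a member of a [set structure]. *)
Definition coordinate (n : nat) : Set := {i : nat | i < n}.

Section Power.
Variables (S : structure) (n : nat).

Lemma power_inhabited : inhabited (coordinate n -> S).
Proof. by case: (carrier_inhabited S) => x; split=> _; exact: x. Qed.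

Definition power_algebra : algebra :=
  @Algebra (coordinate n -> S)
    (fun x y i => meet (x i) (y i))
    (fun x y i => join (x i) (y i))
    (fun x i => neg (x i))
    power_inhabited.

Definition power : structure :=
  @Structure power_algebra [set x | forall i, @des S (x i)].

End Power.

Record subuniverse (A : algebra) (U : set A) : Prop := Subuniverse {
  sub_nonempty : U !=set0;
  sub_meet : forall x y, U x -> U y -> U (meet x y);
  sub_join : forall x y, U x -> U y -> U (join x y);
  sub_neg : forall x, U x -> U (neg x) }.

Section Substructure.
Variables (S : structure) (U : set S) (SU : subuniverse U).

Lemma sub_inhabited : inhabited {x : S | U x}.
Proof. by case: (sub_nonempty SU) => x Ux; split; exists x. Qed.

Definition sub_algebra : algebra :=
  @Algebra {x : S | U x}
    (fun x y => exist U _ (sub_meet SU (proj2_sig x) (proj2_sig y)))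
    (fun x y => exist U _ (sub_join SU (proj2_sig x) (proj2_sig y)))
    (fun x => exist U _ (sub_neg SU (proj2_sig x)))
    sub_inhabited.

Definition substructure : structure :=
  @Structure sub_algebra [set x | @des S (proj1_sig x)].

End Substructure.

Definition is_substructure (B S : structure) : Prop :=
  exists (U : set S) (SU : subuniverse U), B = substructure SU.

(* The language has no constants, so the value on [::] is arbitrary. *)
Definition disj (s : seq formula) : formula :=
  if s is phi :: s' then foldl Or phi s' else Var 0.

(* Meaningful for n > 0 only, where the families indexed by j != i are
   nonempty. *)
Definition PCP (n : nat) (L : logic) : Prop :=
  forall (Gamma : set formula) (phi : 'I_n.+1 -> formula) (psi : formula),
    (forall i : 'I_n.+1,
       L (Gamma `|` [set disj [seq phi j | j <- enum 'I_n.+1 & j != i]]) psi) ->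
    L (Gamma `|` [set disj [seq phi j | j <- enum 'I_n.+1]]) psi.

Definition finitary_with_PCP (n : nat) (L : logic) : Prop :=
  finitary L /\ PCP n L.

Definition complete_wrt_substructures_of_power (n : nat) (L : logic) : Prop :=
  exists K : set structure,
    (forall B, K B -> is_substructure B (power DM1 n)) /\ complete L K.

Definition complete_wrt_finite_n_prime (n : nat) (L : logic) : Prop :=
  exists K : set structure,
    [/\ finite_set K,
        forall S, K S ->
          [/\ finite_structure S, is_demorgan_lattice S &
              n_prime_filter n (@des S)] &
        complete L K].

(* Main.v *)
Require Import Defs.
From mathcomp Require Import all_boot.
From mathcomp Require Import boolp classical_sets functions cardinality filter.

(** (i) => (ii). Let T be an L-theory that is maximal among those omitting phi.
    By the n-PCP, from every disjunction of n+1 formulas in T one disjunct can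
    be dropped. Take n least with this property, n > 1, and let
    phi_1 \/ .. \/ phi_n in T be a disjunction from which no disjunct can be
    dropped. Then each P_i = {chi | chi \/ \/_(j <> i) phi_j in T} is a prime
    filter and T is the intersection of the P_i. For primality, drop a disjunct
    from (chi_1 /\ phi_i) \/ (chi_2 /\ phi_i) \/ \/_(j <> i) phi_j; for the
    intersection, drop one from \/_i (chi /\ phi_i) \/ b, where b is the
    conjunction of all the \/_(j <> i) phi_j. The P_i induce a homomorphism
    from formulas to DM1^n whose image is a model of L refuting phi.

    (ii) => (iii). A join in DM1^n is designated as soon as it is so at each of
    the n coordinates, which takes at most n joinands.

    (iii) => (i). A finite set of finite structures is compact, by an
    ultrafilter argument.

    A finitely generated L has the n-PCP once n bounds the sizes of its
    generating structures. *)

Set Implicit Arguments.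
Unset Strict Implicit.
Unset Printing Implicit Defensive.

Local Open Scope classical_set_scope.
Local Open Scope card_scope.

Lemma finite_set_ind T (P : set T -> Prop) :
  P set0 -> (forall x A, P A -> P (x |` A)) ->
  forall A, finite_set A -> P A.
Proof.
(* [finite_seqP] enumerates sets over a choice type, so [T] is first turned into one. *)
elim/Pchoice: T => T in P *; move=> P0 PU A /finite_seqP[s ->].
elim: s => [|x s IHs].
  by rewrite (_ : [set` _] = set0) //; apply/seteqP; split.
have -> : [set` x :: s] = x |` [set` s]; last exact: PU.
apply/seteqP; split=> y /=; rewrite inE; first by case/predU1P; [left|right].
by case=> ->; rewrite ?eqxx ?orbT.
Qed.

(** * Order and finite suprema in De Morgan lattices *)

Section DeMorganOrder.
Variables (A : algebra) (dmA : is_demorgan_lattice A).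
Implicit Types x y z : A.

Lemma dm_meetxx x : meet x x = x.
Proof. by rewrite -{2}(dm_joinKI dmA x x) (dm_meetKU dmA). Qed.

Lemma lat_le_refl x : lat_le x x. Proof. exact: dm_meetxx. Qed.

Lemma lat_le_trans y x z : lat_le x y -> lat_le y z -> lat_le x z.
Proof. by rewrite /lat_le => <- yz; rewrite -(dm_meetA dmA) yz. Qed.

Lemma lat_le_meetl x y : lat_le (meet x y) x.
Proof. by rewrite /lat_le (dm_meetC dmA) (dm_meetA dmA) dm_meetxx. Qed.

Lemma lat_le_meetr x y : lat_le (meet x y) y.
Proof. by rewrite /lat_le -(dm_meetA dmA) dm_meetxx. Qed.

Lemma lat_le_meet z x y : lat_le z x -> lat_le z y -> lat_le z (meet x y).
Proof. by rewrite /lat_le (dm_meetA dmA) => -> ->. Qed.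

Lemma lat_le_joinl x y : lat_le x (join x y).
Proof. exact: dm_meetKU. Qed.

Lemma lat_le_joinr x y : lat_le y (join x y).
Proof. by rewrite (dm_joinC dmA); apply: lat_le_joinl. Qed.

Lemma lat_le_join x y z : lat_le x z -> lat_le y z -> lat_le (join x y) z.
Proof.
rewrite /lat_le => xz yz.
by rewrite (dm_meetC dmA) (dm_meetUr dmA) !(dm_meetC dmA z) xz yz.
Qed.

(** Infima for the reversed order are suprema. They arise as iterated joins, so they stay in any
    join-closed [Q] that contains [Y]. *)
Lemma finite_sup (Q : set A) :
  (forall x y, Q x -> Q y -> Q (join x y)) ->
  forall Y, finite_set Y -> Y !=set0 -> Y `<=` Q ->
  exists z, Q z /\ is_inf (fun x y => lat_le y x) Y z.
Proof.
move=> QU; apply: finite_set_ind => [[//]|x Y IH _ YQ].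
have Qx : Q x by apply: YQ; left.
(* No bottom element is available, so singletons start the induction. *)
have [->|/set0P Y0] := eqVneq Y set0.
  by exists x; split=> //; split=> [_ [->|//]|z]; [exact: lat_le_refl|apply; left].
have [|z [Qz [ubz lubz]]] := IH Y0; first by move=> y Yy; apply: YQ; right.
exists (join x z); split; first exact: QU.
split=> [y [->|Yy]|w ubw]; first exact: lat_le_joinl.
  by apply: (lat_le_trans (ubz _ Yy)); apply: lat_le_joinr.
by apply: lat_le_join; [apply: ubw; left|apply: lubz => y Yy; apply: ubw; right].
Qed.

End DeMorganOrder.

(** * Inequalities between formulas *)

(** The order of the free De Morgan lattice, given semantically so that its laws are read off from
    lattices instead of derived in a calculus. *)
Definition formula_le (phi psi : formula) : Prop :=
  forall A : algebra, is_demorgan_lattice A ->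
  forall v : formula_algebra -> A, is_hom v -> lat_le (v phi) (v psi).

Section FormulaOrder.
Implicit Types phi psi chi gamma : formula.

Lemma formula_le_refl phi : formula_le phi phi.
Proof. by move=> A dA v _; apply: lat_le_refl. Qed.

Lemma formula_le_trans psi phi chi :
  formula_le phi psi -> formula_le psi chi -> formula_le phi chi.
Proof.
by move=> l1 l2 A dA v hv; apply: (lat_le_trans dA (l1 A dA v hv)); apply: l2.
Qed.

Lemma formula_le_Andl phi psi : formula_le (And phi psi) phi.
Proof. by move=> A dA v [vA _ _]; rewrite vA; apply: lat_le_meetl. Qed.

Lemma formula_le_Andr phi psi : formula_le (And phi psi) psi.
Proof. by move=> A dA v [vA _ _]; rewrite vA; apply: lat_le_meetr. Qed.

Lemma formula_le_And chi phi psi :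
  formula_le chi phi -> formula_le chi psi -> formula_le chi (And phi psi).
Proof.
move=> l1 l2 A dA v hv; case: (hv) => vA _ _; rewrite vA.
by apply: lat_le_meet; [|exact: l1|exact: l2].
Qed.

Lemma formula_le_Orl phi psi : formula_le phi (Or phi psi).
Proof. by move=> A dA v [_ vO _]; rewrite vO; apply: lat_le_joinl. Qed.

Lemma formula_le_Orr phi psi : formula_le psi (Or phi psi).
Proof. by move=> A dA v [_ vO _]; rewrite vO; apply: lat_le_joinr. Qed.

Lemma formula_le_Or phi psi chi :
  formula_le phi chi -> formula_le psi chi -> formula_le (Or phi psi) chi.
Proof.
move=> l1 l2 A dA v hv; case: (hv) => _ vO _; rewrite vO.
by apply: lat_le_join; [|exact: l1|exact: l2].
Qed.

Lemma formula_le_AndOr gamma phi psi chi :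
  formula_le (And gamma phi) chi -> formula_le (And gamma psi) chi ->
  formula_le (And gamma (Or phi psi)) chi.
Proof.
move=> l1 l2 A dA v hv; case: (hv) => vA vO _; rewrite vA vO (dm_meetUr dA).
by rewrite -!vA; apply: lat_le_join; [|exact: l1|exact: l2].
Qed.

Lemma formula_le_AndC phi psi : formula_le (And phi psi) (And psi phi).
Proof.
exact: formula_le_And (formula_le_Andr _ _) (formula_le_Andl _ _).
Qed.

Lemma formula_le_OrC phi psi : formula_le (Or phi psi) (Or psi phi).
Proof.
exact: formula_le_Or (formula_le_Orr _ _) (formula_le_Orl _ _).
Qed.

Lemma formula_le_OrAnd gamma phi psi chi :
  formula_le (And phi gamma) chi -> formula_le (And psi gamma) chi ->
  formula_le (And (Or phi psi) gamma) chi.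
Proof.
move=> l1 l2; apply: formula_le_trans (formula_le_AndC _ _) _.
apply: formula_le_AndOr; apply: formula_le_trans (formula_le_AndC _ _) _.
  exact: l1.
exact: l2.
Qed.

Lemma formula_le_distr phi psi chi :
  formula_le (And (Or phi chi) (Or psi chi)) (Or (And phi psi) chi).
Proof.
apply: formula_le_AndOr; last first.
  exact: formula_le_trans (formula_le_Andr _ _) (formula_le_Orr _ _).
apply: formula_le_OrAnd; first exact: formula_le_Orl.
exact: formula_le_trans (formula_le_Andl _ _) (formula_le_Orr _ _).
Qed.

(** Through this and [BD1_And], every theory of an extension of [BD1] is an upset closed under
    conjunction. *)
Lemma BD1_formula_le phi psi : formula_le phi psi -> BD1 [set phi] psi.
Proof.
move=> l S [dS [upF _]] v hv vF; apply: (upF (v phi)).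
  by apply: vF; exists phi.
exact: l.
Qed.

Lemma BD1_And phi psi : BD1 [set phi; psi] (And phi psi).
Proof.
move=> S [dS [_ mF]] v [vA _ _] vF; rewrite vA; apply: mF; apply: vF.
  by exists phi => //; left.
by exists psi => //; right.
Qed.

End FormulaOrder.

(** * Finite disjunctions *)

Lemma disj_rcons s phi : 0 < size s -> disj (rcons s phi) = Or (disj s) phi.
Proof. by case: s => // psi s _; rewrite /= foldl_rcons. Qed.

Section Disjunctions.
Variables (I : eqType) (phi : I -> formula).
Implicit Types s : seq I.

Lemma disj_ub s j :
  j \in s -> formula_le (phi j) (disj [seq phi i | i <- s]).
Proof.
elim/last_ind: s => [//|s x IHs]; rewrite mem_rcons inE map_rcons.
case: (posnP (size s)) => [/size0nil->|s0] /predU1P[->|js] //.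
- exact: formula_le_refl.
- by rewrite disj_rcons ?size_map //; apply: formula_le_Orr.
rewrite disj_rcons ?size_map //.
exact: formula_le_trans (IHs js) (formula_le_Orl _ _).
Qed.

Lemma And_disj_lub gamma s chi : 0 < size s ->
  (forall j, j \in s -> formula_le (And gamma (phi j)) chi) ->
  formula_le (And gamma (disj [seq phi i | i <- s])) chi.
Proof.
elim/last_ind: s => [//|s x IHs] _ ub; rewrite map_rcons.
case: (posnP (size s)) => [/size0nil s0|s0].
  by rewrite s0; apply: ub; rewrite mem_rcons mem_head.
rewrite disj_rcons ?size_map //; apply: formula_le_AndOr.
  by apply: IHs => // j js; apply: ub; rewrite mem_rcons inE js orbT.
by apply: ub; rewrite mem_rcons mem_head.
Qed.

(** The bound [z] is an arbitrary element rather than the value of a formula, so that the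
    disjunction is seen to be a supremum in [A]. *)
Lemma hom_disj_lub (A : algebra) (dA : is_demorgan_lattice A)
    (v : formula_algebra -> A) (hv : is_hom v) s (z : A) : 0 < size s ->
  (forall j, j \in s -> lat_le (v (phi j)) z) ->
  lat_le (v (disj [seq phi i | i <- s])) z.
Proof.
elim/last_ind: s => [//|s x IHs] _ ub; rewrite map_rcons.
case: (posnP (size s)) => [/size0nil s0|s0].
  by rewrite s0; apply: ub; rewrite mem_rcons mem_head.
case: (hv) => _ vO _; rewrite disj_rcons ?size_map // vO; apply: lat_le_join => //.
  by apply: IHs => // j js; apply: ub; rewrite mem_rcons inE js orbT.
by apply: ub; rewrite mem_rcons mem_head.
Qed.

Lemma disj_lub s chi : 0 < size s ->
  (forall j, j \in s -> formula_le (phi j) chi) ->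
  formula_le (disj [seq phi i | i <- s]) chi.
Proof. by move=> s0 ub A dA v hv; apply: hom_disj_lub => // j /ub; apply. Qed.

End Disjunctions.

(** * Compactness of finite sets of finite structures *)

(** If [R a] is not in the ultrafilter, its complement is, and intersecting with it leaves a cover
    by the remaining sets. *)
Lemma ultra_finite_cover T U (G : set_system T) (K : set U)
    (R : U -> set T) :
  UltraFilter G -> finite_set K -> G [set x | exists2 a, K a & R a x] ->
  exists2 a, K a & G (R a).
Proof.
move=> uG finK; elim/finite_set_ind: K / finK => [|a K IH] GR.
  by have [x []] := @filter_ex _ G _ _ GR.
have [Ga|Gna] := in_ultra_setVsetC (R a) uG; first by exists a; [left|].
have [|b Kb Gb] := IH; last by exists b; [right|].
apply: filterS (filterI GR Gna) => x [[b [->//|Kb] Rb] nR].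
by exists b.
Qed.

Section Compactness.
Variables (K : set structure).
Hypotheses (finK : finite_set K)
  (finKS : forall S, K S -> finite_structure S).

(** If no finite subset of [Gamma] yields [phi], valuations refuting the finite subsets have a limit
    along an ultrafilter, because each formula takes finitely many values. The limit satisfies
    [Gamma] and refutes [phi]. *)
Lemma finite_structures_finitary : finitary (logic_of K).
Proof.
move=> Gamma phi Gphi; apply: contrapT => nofin.
pose D := [set Delta | finite_set Delta /\ Delta `<=` Gamma].
pose refutes (S : structure) (v : formula_algebra -> S) (Delta : set formula) :=
  [/\ is_hom v, v @` Delta `<=` @des S & ~ @des S (v phi)].
pose R S := [set Delta | exists v, @refutes S v Delta].
(* The filter generated by the cones of finite subsets of [Gamma] above a given one. *)
pose F : set_system (set formula) :=
  [set X | exists2 Delta, D Delta &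
    forall Delta', D Delta' -> Delta `<=` Delta' -> X Delta'].
have pF : ProperFilter F.
  apply: Build_ProperFilter_ex.
    by move=> X [Delta DD XD]; exists Delta; apply: XD.
  split.
  - by exists set0 => //; split=> //; apply: finite_set0.
  - move=> X Y [D1 [f1 s1] X1] [D2 [f2 s2] Y2]; exists (D1 `|` D2).
      by split; [rewrite finite_setU|move=> x [/s1|/s2]].
    move=> D' DD' sD; split; [apply: X1|apply: Y2] => // x ?; apply: sD;
    by [left|right].
  - by move=> X Y XY [Delta DD XD]; exists Delta => // D' ? ?; apply/XY/XD.
have [G [uG FG]] := ultraFilterLemma pF.
have GD : G D by apply: FG; exists set0 => //; split=> //; apply: finite_set0.
(* There are finitely many structures, so a single [S] refutes [G]-almost all finite subsets. *)
have [S KS GS] : exists2 S, K S & G (R S).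
  apply: ultra_finite_cover finK _; apply: filterS GD => Delta DD.
  apply: contrapT => nS; apply: nofin; exists Delta.
  case: DD => finD sD; split=> // S KS v hv vD.
  by apply: contrapT => nv; apply: nS; exists S => //; exists v.
have [w wP] : {w : set formula -> formula_algebra -> S &
    forall Delta, R S Delta -> refutes S (w Delta) Delta}.
  apply: (@choice _ _ (fun Delta v => R S Delta -> refutes S v Delta)) => Delta.
  have [[v vP]|nR] := pselect (R S Delta); first by exists v.
  (* A constant map is the default where [S] refutes nothing. *)
  by case: (carrier_inhabited S) => x; exists (fun=> x).
(* The limit: [v psi] is the value that [G]-almost all [w Delta] give to [psi]. *)
have [v vP] : {v : formula_algebra -> S &
    forall psi, G [set Delta | w Delta psi = v psi]}.
  apply: (@choice _ _ (fun psi a => G [set Delta | w Delta psi = a])) => psi.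
  have [a _ Ga] : exists2 a, [set: S] a & G [set Delta | w Delta psi = a].
    apply: ultra_finite_cover (finKS KS) _.
    by apply: filterS GD => Delta _; exists (w Delta psi).
  by exists a.
(* Each equation involves at most three values, on which [v] agrees with a single homomorphism
   [w Delta]. *)
have hv : is_hom v.
  split=> [x y|x y|x].
  - have [Delta [[/= <- <-] [<- /wP[[wA _ _] _ _]]]] :=
      @filter_ex _ G _ _ (filterI (filterI (vP x) (vP y))
                                  (filterI (vP (And x y)) GS)).
    exact: wA.
  - have [Delta [[/= <- <-] [<- /wP[[_ wO _] _ _]]]] :=
      @filter_ex _ G _ _ (filterI (filterI (vP x) (vP y))
                                  (filterI (vP (Or x y)) GS)).
    exact: wO.
  - have [Delta [/= <- [<- /wP[[_ _ wN] _ _]]]] :=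
      @filter_ex _ G _ _ (filterI (vP x) (filterI (vP (Neg x)) GS)).
    exact: wN.
have [Delta [/= wv /wP[_ _ nw]]] := @filter_ex _ G _ _ (filterI (vP phi) GS).
apply: nw; rewrite wv; apply: (Gphi S KS v hv) => _ [g Gg <-].
have Gg' : G [set Delta | Delta g].
  apply: FG; exists [set g]; first by split=> [|_ ->//]; apply: finite_set1.
  by move=> D' _; apply.
have [D' [/= <- [D'g /wP[_ wD _]]]] :=
  @filter_ex _ G _ _ (filterI (vP g) (filterI Gg' GS)).
by apply: wD; exists g.
Qed.

End Compactness.

(** * From n-prime filters to the n-PCP *)

Lemma size_enum_predC1 (I : finType) (i : I) :
  1 < #|I| -> 0 < size [seq j <- enum I | j != i].
Proof.
move=> I1; rewrite size_filter -sum1_count big_enum_cond /= sum1_card.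
by rewrite (cardC1 i) -subn1 subn_gt0.
Qed.

Section NPrimeToPCP.
Variables (n : nat) (K : set structure).

(** Suppose all the shorter disjunctions are undesignated. At most [n] of the values [v (phi j)]
    leave out some index, so their supremum lies below a shorter disjunction and is undesignated. As
    the complement is an n-ideal, the whole disjunction is undesignated too. *)
Lemma n_prime_filter_remove (S : structure) (dS : is_demorgan_lattice S)
    (nF : n_prime_filter n (@des S)) (v : formula_algebra -> S) (hv : is_hom v)
    (phi : 'I_n.+1 -> formula) :
  @des S (v (disj [seq phi j | j <- enum 'I_n.+1])) ->
  exists i, @des S (v (disj [seq phi j | j <- enum 'I_n.+1 & j != i])).
Proof.
case: nF => [[upF _] [_ idF]] vF; apply: contrapT => nex.
pose Y := [set v (phi j) | j in [set: 'I_n.+1]].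
have /idF : finite_set Y by apply: finite_image.
apply; [by exists (v (phi ord0)); exists ord0| |split| exact: vF]; last 2 first.
- move=> _ [j _ <-]; apply: (disj_ub phi) => //; exact: mem_enum.
- move=> z ub.
  apply: hom_disj_lub => //; first by rewrite -cardE card_ord.
  by move=> j _; apply: ub; exists j.
move=> X XY X0 Xn m [ubm lubm] Fm; apply: nex.
(* Choose an index for each element of [X]: at most [n] indices arise, so one of the [n.+1] is
   missed. *)
have /choice[f fP] : forall x, exists j : 'I_n.+1, X x -> v (phi j) = x.
  move=> x; have [Xx|nX] := pselect (X x); last by exists ord0.
  by have [j _ <-] := XY x Xx; exists j.
have [i iP] : exists i : 'I_n.+1, forall x, X x -> f x != i.
  apply: contrapT => nex; suff : `I_n.+1 #<= `I_n by rewrite card_le_II ltnn.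
  apply: card_le_trans Xn.
  apply: card_le_trans (card_image_le (fun x => nat_of_ord (f x)) X).
  apply: subset_card_le => k /= kn; apply: contrapT => nk.
  apply: nex; exists (Ordinal kn) => x Xx.
  by apply/eqP => fx; apply: nk; exists x => //; rewrite fx.
exists i; apply: (upF _ _ Fm); apply: lubm => x Xx.
rewrite -(fP x Xx); apply: (disj_ub phi) => //.
by rewrite mem_filter iP //= mem_enum.
Qed.

Lemma n_prime_class_PCP :
  (forall S, K S -> is_demorgan_lattice S /\ n_prime_filter n (@des S)) ->
  PCP n (logic_of K).
Proof.
move=> Kn Gamma phi psi PC S KS v hv vF; have [dS nS] := Kn S KS.
have [|i Fi] := n_prime_filter_remove dS nS hv (phi := phi).
  by apply: vF; exists (disj [seq phi j | j <- enum 'I_n.+1]); first by right.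
apply: (PC i S KS v hv) => _ [g [Gg|->] <-] //.
by apply: vF; exists g; first by left.
Qed.

End NPrimeToPCP.

(** * The n-PCP for finitely generated logics *)

Lemma finite_structures_bound (K : set structure) :
  finite_set K -> (forall S, K S -> finite_structure S) ->
  exists2 n, 0 < n &
  forall S, K S -> exists2 e : S -> nat, injective e & forall x, e x < n.
Proof.
move=> finK; elim/finite_set_ind: K / finK => [|S K IH] finKS.
  (* Starting at 1 keeps the bound positive even for empty [K]. *)
  by exists 1.
have [|n n0 nP] := IH; first by move=> S' KS'; apply: finKS; right.
have /finite_setP[m] : finite_structure S by apply: finKS; left.
move=> /card_set_bijP[e [em inje _]].
exists (maxn n m); first by rewrite leq_max n0.
move=> S' [->|/nP[e' inje' e'n]].
  exists e; first by move=> x y; apply: inje; rewrite inE.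
  by move=> x; rewrite leq_max orbC (em x).
by exists e' => // x; rewrite leq_max e'n.
Qed.

(* Two of the [n.+1] disjuncts take the same value, so one is redundant. *)
Lemma bounded_class_PCP n (K : set structure) :
  0 < n -> extension BD1 (logic_of K) ->
  (forall S, K S -> exists2 e : S -> nat, injective e & forall x, e x < n) ->
  PCP n (logic_of K).
Proof.
move=> n0 extK Kn Gamma phi psi PC S KS v hv vF.
have [e inje en] := Kn S KS.
have [i [k ik vik]] : exists i, exists2 k, i != k & v (phi i) = v (phi k).
  have /injectivePn[i [k ik /(congr1 val) /inje vik]] :
      ~~ injectiveb (fun j => Ordinal (en (v (phi j)))).
    by apply/negP => /injectiveP/leq_card; rewrite !card_ord ltnn.
  by exists i; exists k.
(* The members of [K] need not be lattices, so the disjunction cannot be rearranged inside [S].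
   Replacing [phi i] by [phi k] in place keeps its value; removing the repetition is then an
   inference of [BD1]. *)
pose phi' j := if j == i then phi k else phi j.
have vd : v (disj [seq phi j | j <- enum 'I_n.+1]) =
          v (disj [seq phi' j | j <- enum 'I_n.+1]).
  have vphi' j : v (phi j) = v (phi' j) by rewrite /phi'; case: eqP => // ->.
  elim/last_ind: (enum _) => [//|s x IHs]; rewrite !map_rcons.
  case: (posnP (size s)) => [/size0nil->|s0]; first exact: vphi'.
  by case: (hv) => _ vO _; rewrite !disj_rcons ?size_map // !vO IHs vphi'.
apply: (PC i S KS v hv) => _ [g [Gg|->] <-] /=.
  by apply: vF; exists g; first by left.
have le' : formula_le (disj [seq phi' j | j <- enum 'I_n.+1])
                      (disj [seq phi j | j <- enum 'I_n.+1 & j != i]).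
  apply: (@disj_lub _ phi'); first by rewrite -cardE card_ord.
  move=> j _; rewrite /phi'; case: eqP => [_|/eqP ji]; apply: disj_ub.
    by rewrite mem_filter eq_sym ik mem_enum.
  by rewrite mem_filter ji mem_enum.
apply: (extK _ _ (BD1_formula_le le') S KS v hv).
move=> _ [_ -> <-]; rewrite -vd.
by apply: vF; exists (disj [seq phi j | j <- enum 'I_n.+1]); first by right.
Qed.


(** * Substructures of powers of DM1: n-primeness and finiteness *)

Section PowerOfDM1.
Variable n : nat.
Hypothesis n_gt0 : 0 < n.

Lemma DM1_demorgan : is_demorgan_lattice DM1.
Proof. by split; do ![case]. Qed.

Lemma substructure_eq (S : structure) (U : set S) (SU : subuniverse U)
  (x y : substructure SU) : proj1_sig x = proj1_sig y -> x = y.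
Proof. by case: x y => [x Ux] [y Uy] /= xy; apply: eq_exist. Qed.

Lemma power_demorgan : is_demorgan_lattice (power DM1 n).
Proof.
by split=> *; apply/funext => i /=; apply DM1_demorgan.
Qed.

Lemma substructure_demorgan (S : structure) (U : set S) (SU : subuniverse U) :
  is_demorgan_lattice S -> is_demorgan_lattice (substructure SU).
Proof. by move=> dS; split=> *; apply: substructure_eq; apply dS. Qed.

Lemma four_meet_des (x y : DM1) :
  @des DM1 (meet x y) <-> @des DM1 x /\ @des DM1 y.
Proof. by case: x; case: y => /=; split; intuition discriminate. Qed.

Lemma four_join_des (x y : DM1) :
  @des DM1 (join x y) <-> @des DM1 x \/ @des DM1 y.
Proof. by case: x; case: y => /=; split; intuition discriminate. Qed.

Lemma coordinate_card_le T (f : coordinate n -> T) : range f #<= `I_n.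
Proof.
have [g gP] : {g : nat -> coordinate n & forall i : coordinate n, g (sval i) = i}.
  (* The default coordinate 0 exists because [n] is positive. *)
  exists (fun k => insubd (exist _ 0 n_gt0 : coordinate n) k) => i.
  exact: valKd.
apply: card_le_trans (card_image_le (f \o g) _).
by apply: subset_card_le => _ [i _ <-]; exists (sval i); [case: i|rewrite /= gP].
Qed.

Variables (U : set (power DM1 n)) (SU : subuniverse U).
Let B := substructure SU.

(** If the supremum of [Y] is designated, each coordinate has a member of [Y] designated there. The
    supremum of these at most [n] members is already designated. *)
Lemma substructure_power_n_prime : n_prime_filter n (@des B).
Proof.
have dB : is_demorgan_lattice B.
  exact: substructure_demorgan power_demorgan.
have leB (x y : B) i : lat_le x y -> @des DM1 (sval x i) -> @des DM1 (sval y i).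
  move=> /(congr1 (fun z => sval z i)) /= <-.
  by case/(four_meet_des (sval x i)).
have upF : upset (@lat_le B) (@des B) by move=> x y Fx xy i; apply: leB xy (Fx i).
split; first by split=> // x y Fx Fy i; apply/four_meet_des.
split; first by move=> x y nx yx Fy; apply: nx; apply: upF yx.
move=> Y finY Y0 nX m [ubm lubm] Fm.
have /choice[f fP] : forall i, exists y, Y y /\ @des DM1 (sval y i).
  move=> i; apply: contrapT => nY.
  pose Q := [set x : B | ~ @des DM1 (sval x i)].
  (* As [{t, b}] is prime, being undesignated at [i] is preserved by joins, hence by the supremum of
     [Y]. *)
  have [||z [nz [ubz _]]] := finite_sup dB (Q := Q) _ finY Y0.
  - by move=> x y nx ny /four_join_des[].
  - by move=> y Yy Fy; apply: nY; exists y.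
  by apply: nz; apply: leB (lubm _ ubz) (Fm i).
have finf : finite_set (range f).
  by apply/finite_set_leP; exists n; apply: coordinate_card_le.
have f0 : range f !=set0 by exists (f (exist _ 0 n_gt0)); exists (exist _ 0 n_gt0).
have [//|//|z [_ supz]] := finite_sup dB (Q := setT) _ finf f0.
apply: (nX (range f) _ _ _ z supz) => //.
- by move=> _ [i _ <-]; case: (fP i).
- exact: coordinate_card_le.
move=> i; case: supz => ubz _; case: (fP i) => _; apply: leB.
by apply: ubz; exists i.
Qed.

End PowerOfDM1.

Lemma finite_power_carrier n : finite_set [set: power DM1 n].
Proof.
pose four_of (k : 'I_4) := nth Ff [:: Ff; Fn; Fb; Ft] k.
have four_ofP (x : four) : exists k, four_of k = x.
  by case: x; [exists (@Ordinal 4 0 isT)|exists (@Ordinal 4 1 isT)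
              |exists (@Ordinal 4 2 isT)|exists (@Ordinal 4 3 isT)].
pose g (h : {ffun 'I_n -> 'I_4}) : power DM1 n :=
  fun i => four_of (h (Ordinal (proj2_sig i))).
apply: (@sub_finite_set _ _ (range g)); last exact/finite_image/finite_finset.
move=> x _; have /choice[k kP] : forall i : coordinate n, exists k, four_of k = x i.
  by move=> i; apply: four_ofP.
exists [ffun i : 'I_n => k (exist _ (val i) (ltn_ord i))] => //.
by apply/funext => -[i ilt]; rewrite /g ffunE /= kP; congr (x _); apply: eq_exist.
Qed.

Lemma finite_set_of_sets T : finite_set [set: T] -> finite_set [set: set T].
Proof.
move=> /finite_setP[m] /card_set_bijP[e [em inje _]].
pose g (A : {set 'I_m}) : set T := [set x | exists2 i : 'I_m, i \in A & e x = i].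
apply: (@sub_finite_set _ _ (range g)); last exact/finite_image/finite_finset.
move=> X _; exists [set i : 'I_m | `[< exists2 x, X x & e x = i >]]%SET => //.
apply/seteqP; split=> [x [i]|x Xx].
  rewrite inE => /asboolP[y Xy <-] /inje; rewrite !inE => -> //.
by exists (Ordinal (em x I)) => //; rewrite inE; apply/asboolP; exists x.
Qed.

Lemma finite_substructures n :
  finite_set [set B | is_substructure B (power DM1 n)].
Proof.
(* The whole power is a default for sets that are not subuniverses. By proof irrelevance, a
   subuniverse determines one structure. *)
pose f (U : set (power DM1 n)) : structure :=
  if pselect (subuniverse U) is left SU then substructure SU else power DM1 n.
apply: (@sub_finite_set _ _ (range f)).
  move=> _ [U [SU ->]]; exists U => //; rewrite /f; case: pselect => // SU'.
  by rewrite (Prop_irrelevance SU SU').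
exact/finite_image/finite_set_of_sets/finite_power_carrier.
Qed.

Lemma finite_substructure n (B : structure) :
  is_substructure B (power DM1 n) -> finite_structure B.
Proof.
move=> [U [SU ->]]; rewrite /finite_structure -(preimage_setT (@proj1_sig _ U)).
apply: finite_preimage (finite_power_carrier n).
by move=> x y _ _; apply: substructure_eq.
Qed.

(** * Decomposition of n-prime theories into prime filters *)

(** The empty set and the set of all formulas are included; they give the constant valuations [Fn]
    and [Fb]. *)
Definition prime_filter (P : set formula) : Prop :=
  [/\ forall phi psi, formula_le phi psi -> P phi -> P psi,
      forall phi psi, P phi -> P psi -> P (And phi psi) &
      forall phi psi, P (Or phi psi) -> P phi \/ P psi].

(* What the [n]-PCP says about theories that are maximal among those omitting
   a given formula. *)
Definition n_prime (n : nat) (T : set formula) : Prop :=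
  forall (I : finType) (phi : I -> formula), #|I| = n.+1 ->
    T (disj [seq phi j | j <- enum I]) ->
    exists i, T (disj [seq phi j | j <- enum I & j != i]).

(** Transport along a bijection: the n-PCP is indexed by ['I_n.+1], the arguments below by
    [option I] and [bool]. Reordering disjuncts is harmless in an upset. *)
Lemma n_prime_ord n (T : set formula) :
  (forall phi : 'I_n.+1 -> formula,
    T (disj [seq phi j | j <- enum 'I_n.+1]) ->
    exists i, T (disj [seq phi j | j <- enum 'I_n.+1 & j != i])) ->
  (forall phi psi, formula_le phi psi -> T phi -> T psi) ->
  0 < n -> n_prime n T.
Proof.
move=> Tn Tup n0 I phi cI TI.
have [f [g fK gK]] : {f : 'I_n.+1 -> I & bijective f}.
  rewrite -cI; exists enum_val; exists enum_rank; first exact: enum_valK.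
  exact: enum_rankK.
have [|i Ti] := Tn (phi \o f).
  apply: Tup TI; apply: (@disj_lub _ phi); first by rewrite -cardE cI.
  by move=> j _; rewrite -(gK j); apply: (disj_ub (phi \o f)); rewrite mem_enum.
exists (f i); apply: Tup Ti; apply: disj_lub.
  by apply: size_enum_predC1; rewrite card_ord.
move=> j; rewrite mem_filter => /andP[ji _]; apply: (disj_ub phi).
by rewrite mem_filter mem_enum (can_eq fK) ji.
Qed.

Section PrimeDecomposition.
Variable T : set formula.
Hypotheses (T_up : forall phi psi, formula_le phi psi -> T phi -> T psi)
  (T_And : forall phi psi, T phi -> T psi -> T (And phi psi)).

Section IrredundantDisjunction.
Variables (n : nat) (I : finType) (phi : I -> formula).
Hypotheses (Tn : n_prime n T) (cardI : #|I| = n) (n_gt1 : 1 < n)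
  (TI : T (disj [seq phi j | j <- enum I]))
  (nTI : forall i, ~ T (disj [seq phi j | j <- enum I & j != i])).

Let D i := disj [seq phi j | j <- enum I & j != i].
Let component i := [set chi | T (Or chi (D i))].

(** [option I] provides one slot more than [phi] has, so that n-primeness applies. *)
Lemma card_option_I : #|{: option I}| = n.+1.
Proof. by rewrite card_option cardI. Qed.

Lemma phi_le_D i j : j != i -> formula_le (phi j) (D i).
Proof. by move=> ji; apply: disj_ub; rewrite mem_filter ji mem_enum. Qed.

Lemma disj_option_le (psi : option I -> formula) o chi :
  (forall o', o' != o -> formula_le (psi o') chi) ->
  formula_le (disj [seq psi j | j <- enum {: option I} & j != o]) chi.
Proof.
move=> ub; apply: (@disj_lub _ psi).
  by apply: size_enum_predC1; rewrite card_option_I ltnW.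
by move=> j; rewrite mem_filter => /andP[jo _]; apply: ub.
Qed.

Lemma component_prime i : prime_filter (component i).
Proof.
have And_intro chi1 chi2 :
    component i chi1 -> component i chi2 -> component i (And chi1 chi2).
  by move=> T1 T2; apply: T_up (T_And T1 T2); apply: formula_le_distr.
have up chi1 chi2 : formula_le chi1 chi2 -> component i chi1 -> component i chi2.
  move=> le12; apply: T_up; apply: formula_le_Or (formula_le_Orr _ _).
  exact: formula_le_trans le12 (formula_le_Orl _ _).
split=> // chi1 chi2 T12.
have phi_i : component i (phi i).
  apply: T_up TI; apply: (@disj_lub _ phi); first by rewrite -cardE cardI ltnW.
  move=> j _; have [->|ji] := eqVneq j i; first exact: formula_le_Orl.
  exact: formula_le_trans (phi_le_D ji) (formula_le_Orr _ _).
(* Slot [i] holds [And chi1 (phi i)], the extra slot [And chi2 (phi i)]. Up to [D i], dropping slot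
   [i] leaves [chi2] and dropping [None] leaves [chi1]. *)
pose psi o := if o is Some j then if j == i then And chi1 (phi i) else phi j
              else And chi2 (phi i).
have psi_ub o : formula_le (psi o) (disj [seq psi j | j <- enum {: option I}]).
  by apply: disj_ub; rewrite mem_enum.
have [|[k|] Tk] := Tn card_option_I (phi := psi).
- apply: T_up (And_intro _ _ T12 phi_i); apply: formula_le_Or.
    apply: formula_le_OrAnd; last exact: (psi_ub None).
    by have := psi_ub (Some i); rewrite /= eqxx.
  apply: (@disj_lub _ phi).
    by apply: size_enum_predC1; rewrite cardI.
  move=> j; rewrite mem_filter => /andP[/negPf ji _].
  by have := psi_ub (Some j); rewrite /= ji.
- have [ki|ki] := eqVneq k i.
    right; apply: T_up Tk; apply: disj_option_le => -[j|] /=.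
      rewrite ki => ji; have {}ji : j != i by apply: contraNneq ji => ->.
      rewrite (negPf ji).
      exact: formula_le_trans (phi_le_D ji) (formula_le_Orr _ _).
    by move=> _; apply: formula_le_trans (formula_le_Andl _ _) (formula_le_Orl _ _).
  (* For [k != i] all that is left lies below [D k], against irredundancy. *)
  exfalso; apply: (nTI (i := k)); apply: T_up Tk; apply: disj_option_le.
  have phi_ik : formula_le (phi i) (D k) by apply: phi_le_D; rewrite eq_sym.
  move=> [j|] /= jk; last exact: formula_le_trans (formula_le_Andr _ _) phi_ik.
  case: eqP => _; first exact: formula_le_trans (formula_le_Andr _ _) phi_ik.
  by apply: phi_le_D; apply: contraNneq jk => ->.
left; apply: T_up Tk; apply: disj_option_le => -[j|//] _ /=.
case: eqVneq => [_|ji].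
  exact: formula_le_trans (formula_le_Andl _ _) (formula_le_Orl _ _).
exact: formula_le_trans (phi_le_D ji) (formula_le_Orr _ _).
Qed.

Lemma component_bigcap chi : (forall i, component i chi) -> T chi.
Proof.
move=> Tchi.
(* [b] is the conjunction of all the [D i], and distributivity merges the memberships of
   [Or (D i) chi]. It is built along a nonempty list, as there is no empty conjunction. *)
have [b bD Tb] : exists2 b, forall i, formula_le b (D i) & T (Or b chi).
  suff : 0 < size (enum I) -> exists2 b,
      forall i, i \in enum I -> formula_le b (D i) & T (Or b chi).
    rewrite -cardE cardI => -[|b bD Tb]; first exact: ltnW.
    by exists b => // i; apply: bD; rewrite mem_enum.
  have T1 i : T (Or (D i) chi) by apply: T_up (Tchi i); apply: formula_le_OrC.
  elim: (enum I) => [//|i [|j s] IHs] _.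
    by exists (D i) => // j; rewrite inE => /eqP->; apply: formula_le_refl.
  have [//|b bD Tb] := IHs; exists (And (D i) b).
    move=> k; rewrite inE => /predU1P[->|/bD le_b]; first exact: formula_le_Andl.
    exact: formula_le_trans (formula_le_Andr _ _) le_b.
  by apply: T_up (T_And (T1 i) Tb); apply: formula_le_distr.
(* Dropping slot [k] would leave a formula below [D k], against irredundancy, so [b] is dropped and
   the rest lies below [chi]. *)
pose psi o := if o is Some j then And chi (phi j) else b.
have psi_ub o : formula_le (psi o) (disj [seq psi j | j <- enum {: option I}]).
  by apply: disj_ub; rewrite mem_enum.
have [|[k|] Tk] := Tn card_option_I (phi := psi).
- apply: T_up (T_And Tb TI); apply: And_disj_lub; first by rewrite -cardE cardI ltnW.
  move=> j _; apply: formula_le_OrAnd; last exact: (psi_ub (Some j)).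
  exact: formula_le_trans (formula_le_Andl _ _) (psi_ub None).
- exfalso; apply: (nTI (i := k)); apply: T_up Tk; apply: disj_option_le.
  move=> [j|] /= jk; last exact: bD.
  apply: formula_le_trans (formula_le_Andr _ _) _.
  by apply: phi_le_D; apply: contraNneq jk => ->.
apply: T_up Tk; apply: disj_option_le => -[j|//] _; exact: formula_le_Andl.
Qed.

Lemma component_sub chi i : T chi -> component i chi.
Proof. by apply: T_up; apply: formula_le_Orl. Qed.

End IrredundantDisjunction.

(** The base case: dropping one of two disjuncts is primeness itself. *)
Lemma one_prime_filter : n_prime 1 T -> prime_filter T.
Proof.
move=> T1; split=> // phi psi Tor.
pose f (b : bool) := if b then phi else psi.
have f_ub b : formula_le (f b) (disj [seq f j | j <- enum {: bool}]).
  by apply: disj_ub; rewrite mem_enum.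
have [||i] := T1 _ f; first by rewrite card_bool.
  apply: T_up Tor; exact: formula_le_Or (f_ub true) (f_ub false).
have le_f : formula_le (disj [seq f j | j <- enum {: bool} & j != i]) (f (~~ i)).
  apply: (@disj_lub _ f).
    by apply: size_enum_predC1; rewrite card_bool.
  move=> j; rewrite mem_filter => /andP[ji _].
  by rewrite (_ : ~~ i = j); [exact: formula_le_refl|case: i j ji => -[]].
by move=> /(T_up le_f); case: i {le_f}; [right|left].
Qed.

Lemma prime_decomposition n : n_prime n.+1 T ->
  exists P : nat -> set formula, (forall k, prime_filter (P k)) /\
    forall chi, T chi <-> (forall k, k < n.+1 -> P k chi).
Proof.
elim: n => [|n IHn] Tn.
  exists (fun=> T); split=> [_|chi]; first exact: one_prime_filter.
  by split=> [//|/(_ 0)]; apply.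
have [/IHn[P [primeP TP]]|] := pselect (n_prime n.+1 T).
  (* The first [n.+1] filters suffice; the last is repeated. *)
  exists (fun k => P (minn k n)); split=> // chi; rewrite TP; split=> Pchi k kn.
    by apply: Pchi; rewrite ltnS geq_minr.
  by have := Pchi k (ltnW kn); rewrite (minn_idPl _).
move=> /existsNP[I /existsNP[phi /not_implyP[cI /not_implyP[TI /forallNP nTI]]]].
have [i0 _] : exists i : I, i \in I by apply/card_gt0P; rewrite cI.
(* The components listed by number; beyond the range, [i0] repeats one of them, so every [P k] is
   prime. *)
pose P k := [set chi |
  T (Or chi (disj [seq phi j | j <- enum I & j != nth i0 (enum I) k]))].
exists P; split=> [k|chi]; first exact: (component_prime Tn cI).
split=> [Tchi k _|Pchi]; first exact: component_sub.
apply: (component_bigcap Tn cI _ TI nTI) => // i.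
have := Pchi (index i (enum I)); rewrite /P /= nth_index ?mem_enum //; apply.
by rewrite -cI cardE index_mem mem_enum.
Qed.

End PrimeDecomposition.

(** * Valuations in DM1 given by prime filters *)

(** [p] and [q] tell whether a formula and its negation hold: [Fb] is both, [Fn] neither. *)
Definition four_of (p q : bool) : four :=
  if p then if q then Fb else Ft else if q then Ff else Fn.

Definition prime_valuation (P : set formula) (phi : formula) : four :=
  four_of `[< P phi >] `[< P (Neg phi) >].

Section PrimeValuation.
Variable P : set formula.
Hypothesis primeP : prime_filter P.
Implicit Types phi psi : formula.

Lemma prime_And phi psi : `[< P (And phi psi) >] = `[< P phi >] && `[< P psi >].
Proof.
case: primeP => up mP _; rewrite -asbool_and; apply/asbool_equiv_eq; split=> [PA|[]].
  by split; apply: up PA; [apply: formula_le_Andl|apply: formula_le_Andr].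
exact: mP.
Qed.

Lemma prime_Or phi psi : `[< P (Or phi psi) >] = `[< P phi >] || `[< P psi >].
Proof.
case: primeP => up _ jP; rewrite -asbool_or; apply/asbool_equiv_eq; split=> [/jP//|[]].
  by apply: up; apply: formula_le_Orl.
by apply: up; apply: formula_le_Orr.
Qed.

Lemma prime_formula_eq phi psi :
  (forall A, is_demorgan_lattice A ->
   forall v : formula_algebra -> A, is_hom v -> v phi = v psi) ->
  `[< P phi >] = `[< P psi >].
Proof.
move=> eqv; case: primeP => up _ _; apply/asbool_equiv_eq.
by split; apply: up => A dA v hv; rewrite (eqv A dA v hv); apply: lat_le_refl.
Qed.

(** De Morgan's laws and double negation push the outer negation inwards, after which primeness
    computes both bits. *)
Lemma prime_valuation_hom : @is_hom formula_algebra DM1 (prime_valuation P).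
Proof.
split=> [x y|x y|x] /=; rewrite /prime_valuation.
- rewrite prime_And (_ : `[< P (Neg (And x y)) >] = `[< P (Or (Neg x) (Neg y)) >]).
    rewrite prime_Or.
    by case: `[< P x >]; case: `[< P y >]; case: `[< P (Neg x) >]; case: `[< _ >].
  by apply: prime_formula_eq => A dA v [vA vO vN]; rewrite vO !vN vA (dm_neg_meet dA).
- rewrite prime_Or (_ : `[< P (Neg (Or x y)) >] = `[< P (And (Neg x) (Neg y)) >]).
    rewrite prime_And.
    by case: `[< P x >]; case: `[< P y >]; case: `[< P (Neg x) >]; case: `[< _ >].
  by apply: prime_formula_eq => A dA v [vA vO vN]; rewrite vA !vN vO (dm_neg_join dA).
- rewrite (_ : `[< P (Neg (Neg x)) >] = `[< P x >]).
    by case: `[< P x >]; case: `[< _ >].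
  by apply: prime_formula_eq => A dA v [vA vO vN]; rewrite !vN (dm_negK dA).
Qed.

Lemma prime_valuation_des phi : @des DM1 (prime_valuation P phi) <-> P phi.
Proof.
rewrite /prime_valuation; case: asboolP => Pphi; case: asbool => /=.
- by split=> // _; right.
- by split=> // _; left.
- by split=> // -[].
- by split=> // -[].
Qed.

End PrimeValuation.

(** * Maximal theories and canonical structures *)

Section Completeness.
Variables (n : nat) (L : logic).
Hypotheses (n_gt0 : 0 < n) (extL : extension BD1 L).

(** Zorn's lemma for the sets that can be added to [Gamma] without yielding [phi]: by finitarity, a
    consequence of the union of a nonempty chain already follows from one member. *)
Lemma maximal_theory Gamma phi : finitary L -> ~ L Gamma phi ->
  exists T : set formula, [/\ Gamma `<=` T, L T `<=` T, ~ T phi &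
    forall psi, ~ T psi -> L (T `|` [set psi]) phi].
Proof.
move=> finL nGphi.
have [|A [nA maxA]] := @Zorn_bigcup _ [set A | ~ L (Gamma `|` A) phi].
  move=> F FP totF /= /finL[G0 [finG0 sG0 G0phi]].
  have [[A FA]|noF] := pselect (F !=set0); last first.
    apply: nGphi; apply: entails_mono G0phi => x /sG0[//|[A FA]].
    by case: noF; exists A.
  have [B FB sB] : exists2 B, F B & G0 `<=` Gamma `|` B.
    elim/finite_set_ind: G0 / finG0 sG0 {G0phi} => [_|x G0 IH sG0].
      by exists A => // x [].
    have [|B FB sB] := IH; first by move=> y G0y; apply: sG0; right.
    have [Gx|[C FC Cx]] : (Gamma `|` \bigcup_(X in F) X) x by apply: sG0; left.
      by exists B => // y [->|/sB]; first left.
    have [BC|CB] := totF B C FB FC.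
      by exists C => // y [->|/sB[]]; [right|left|move=> /BC; right].
    by exists B => // y [->|/sB//]; right; apply: CB.
  by apply: (FP B FB); apply: entails_mono G0phi.
(* The consequences of the maximal set form a theory, and any formula outside it properly enlarges
   [A]. *)
exists (L (Gamma `|` A)); split=> //.
- by move=> x Gx; apply: entails_refl; left.
- by move=> x; apply: entails_cut.
move=> psi nTpsi; have : ~ ~ L (Gamma `|` (A `|` [set psi])) phi.
  apply: maxA; split; first by move=> x; left.
  by move=> sA; apply: nTpsi; apply: entails_refl; right; apply: sA; right.
move=> /contrapT; apply: entails_mono => x [Gx|[Ax|->]]; last by right.
  by left; apply: entails_refl; left.
by left; apply: entails_refl; right.
Qed.

Section Canonical.
Variables (T : set formula) (P : nat -> set formula).
Hypotheses (T_closed : L T `<=` T) (primeP : forall k, prime_filter (P k))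
  (TP : forall chi, T chi <-> forall k, k < n -> P k chi).

Definition canonical_valuation (phi : formula) : power DM1 n :=
  fun i => prime_valuation (P (sval i)) phi.

Lemma canonical_valuation_hom :
  @is_hom formula_algebra (power DM1 n) canonical_valuation.
Proof.
split=> *; apply/funext => i; rewrite /canonical_valuation;
by have [vA vO vN] := prime_valuation_hom (primeP (sval i)); rewrite ?vA ?vO ?vN.
Qed.

Lemma canonical_valuation_des phi :
  @des (power DM1 n) (canonical_valuation phi) <-> T phi.
Proof.
rewrite TP; split=> [Fv k kn|Pphi i].
  exact/prime_valuation_des/(Fv (exist _ k kn)).
exact/prime_valuation_des/Pphi/(proj2_sig i).
Qed.

Lemma canonical_subuniverse : subuniverse (range canonical_valuation).
Proof.
have [vA vO vN] := canonical_valuation_hom.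
split; first by exists (canonical_valuation (Var 0)); exists (Var 0).
- by move=> _ _ [x _ <-] [y _ <-]; exists (And x y).
- by move=> _ _ [x _ <-] [y _ <-]; exists (Or x y).
- by move=> _ [x _ <-]; exists (Neg x).
Qed.

Definition canonical_structure : structure := substructure canonical_subuniverse.

Definition canonical_hom (phi : formula) : canonical_structure :=
  exist _ (canonical_valuation phi) (ex_intro2 _ _ phi I erefl).

Lemma canonical_homP : @is_hom formula_algebra canonical_structure canonical_hom.
Proof.
have [vA vO vN] := canonical_valuation_hom.
by split=> *; apply: substructure_eq; rewrite /= ?vA ?vO ?vN.
Qed.

Fixpoint subst (s : nat -> formula) (phi : formula) : formula :=
  match phi with
  | Var p => s p
  | And x y => And (subst s x) (subst s y)
  | Or x y => Or (subst s x) (subst s y)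
  | Neg x => Neg (subst s x)
  end.

(* Valuations in the canonical structure lift along [canonical_valuation] to
   substitutions, under which [T] is stable because [L] is structural. *)
Lemma canonical_structure_model Delta psi :
  L Delta psi -> valid canonical_structure Delta psi.
Proof.
move=> Dpsi w [wA wO wN] wD.
have /choice[s sP] : forall p, exists x, canonical_valuation x = sval (w (Var p)).
  by move=> p; case: (w (Var p)) => _ /= [x _ <-]; exists x.
have [vA vO vN] := canonical_valuation_hom.
have liftE x : canonical_valuation (subst s x) = sval (w x).
  elim: x => [p|x IHx y IHy|x IHx y IHy|x IHx] //=.
  - by rewrite vA wA IHx IHy.
  - by rewrite vO wO IHx IHy.
  - by rewrite vN wN IHx.
rewrite /= -liftE; apply/canonical_valuation_des/T_closed.
apply: entails_mono (entails_subst (s := subst s) _ Dpsi); last by split.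
move=> _ [g Dg <-]; apply/canonical_valuation_des; rewrite liftE.
by apply: wD; exists g.
Qed.

End Canonical.

Lemma PCP_complete_substructures :
  finitary_with_PCP n L -> complete_wrt_substructures_of_power n L.
Proof.
move=> [finL pcpL].
(* Taking all substructures that are models of [L] makes soundness immediate. *)
exists [set B | is_substructure B (power DM1 n) /\
                forall Gamma phi, L Gamma phi -> valid B Gamma phi].
split=> [B []//|Gamma phi]; split=> [Gphi B [_]|Kphi]; first exact.
apply: contrapT => nGphi.
have [T [GT T_closed nTphi maxT]] := maximal_theory finL nGphi.
have T_up x y : formula_le x y -> T x -> T y.
  move=> /BD1_formula_le/extL Lxy Tx; apply: T_closed.
  by apply: entails_mono Lxy => _ ->.
have T_And x y : T x -> T y -> T (And x y).
  move=> Tx Ty; apply: T_closed; have /extL := @BD1_And x y; apply: entails_mono.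
  by move=> _ [->|->].
(* If no disjunct could be dropped, by maximality [phi] would follow from [T] with each shorter
   disjunction, hence from [T] by the n-PCP. *)
have Tn : n_prime n T.
  apply: n_prime_ord => // psi Tpsi; apply: contrapT => /forallNP nT.
  apply: nTphi; apply: T_closed.
  have := pcpL T psi phi (fun i => maxT _ (nT i)).
  by apply: entails_mono => x [//|->].
have [P [primeP TP]] : exists P : nat -> set formula,
    (forall k, prime_filter (P k)) /\
    forall chi, T chi <-> (forall k, k < n -> P k chi).
  by move: Tn; rewrite -(prednK n_gt0); apply: prime_decomposition.
apply: nTphi; apply/(canonical_valuation_des TP).
apply: (Kphi (canonical_structure primeP) _ (canonical_hom primeP)
  (canonical_homP primeP)).
  split.
    by exists (range (canonical_valuation P)), (canonical_subuniverse primeP).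
  exact: canonical_structure_model T_closed primeP TP.
by move=> _ [g Gg <-]; apply/(canonical_valuation_des TP)/GT.
Qed.

(** * The remaining implications *)

Lemma substructures_n_prime :
  complete_wrt_substructures_of_power n L -> complete_wrt_finite_n_prime n L.
Proof.
move=> [K [Ksub LK]]; exists K; split=> //.
  exact: sub_finite_set Ksub (finite_substructures n).
move=> B /Ksub subB; split; first exact: finite_substructure subB.
  by case: subB => U [SU ->]; apply: substructure_demorgan; apply: power_demorgan.
by case: subB => U [SU ->]; apply: substructure_power_n_prime.
Qed.

Lemma complete_finitary_with_PCP (K : set structure) : complete L K ->
  finitary_with_PCP n (logic_of K) -> finitary_with_PCP n L.
Proof.
move=> LK [finK pcpK]; split=> [Gamma phi /LK/finK[G0 [? ? ?]]|Gamma phi psi PC].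
  by exists G0; split=> //; apply/LK.
by apply/LK/pcpK => i; apply/LK.
Qed.

Lemma n_prime_finitary_with_PCP :
  complete_wrt_finite_n_prime n L -> finitary_with_PCP n L.
Proof.
move=> [K [finK KS LK]]; apply: (complete_finitary_with_PCP LK); split.
  by apply: finite_structures_finitary => // S /KS[].
by apply: n_prime_class_PCP => // S /KS[].
Qed.

End Completeness.

Theorem mainTheorem11 :
  (forall n : nat, 0 < n -> forall L : logic, extension BD1 L ->
     (finitary_with_PCP n L <-> complete_wrt_substructures_of_power n L) /\
     (complete_wrt_substructures_of_power n L <->
      complete_wrt_finite_n_prime n L)) /\
  (forall L : logic, extension BD1 L -> finitely_generated L ->
     exists n : nat,
       [/\ 0 < n,
           finitary_with_PCP n L,
           complete_wrt_substructures_of_power n L &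
           complete_wrt_finite_n_prime n L]).
Proof.
split=> [n n0 L extL|L extL [K [finK finKS LK]]].
  split; split.
  - exact: PCP_complete_substructures.
  - by move=> /(substructures_n_prime n0)/n_prime_finitary_with_PCP.
  - exact: substructures_n_prime.
  - by move=> /n_prime_finitary_with_PCP/(PCP_complete_substructures n0 extL).
have [n n0 Kn] := finite_structures_bound finK finKS.
have L1 : finitary_with_PCP n L.
  apply: (complete_finitary_with_PCP LK); split.
    exact: finite_structures_finitary.
  by apply: bounded_class_PCP => // Gamma phi /extL/LK.
have L2 := PCP_complete_substructures n0 extL L1.
by exists n; split=> //; apply: substructures_n_prime.
Qed.
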